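(* Let $k,r,s,\nu$ be arbitrary natural numbers (positive integers) and put $p=\frac{r}{r+s}$, $n=k(r+s)$, $\varepsilon=\frac1{r+s}$, $\delta=\nu\varepsilon=\frac{\nu}{r+s}$. Let $X_1,\dots,X_n$ be independent random variables with $\mathbf{Pr}(X_i=1)=p$ and $\mathbf{Pr}(X_i=0)=1-p$. Then: (i) if $r\ge s$ (that is, $p\ge0.5$), $$\mathbf{Pr}\left(\frac1n\sum_{i=1}^nX_i-p>\delta\right)\le\frac12\exp\left(-\frac{n\delta^2}{2p(1-p)}\right);$$ (ii) if $r\le s$ (that is, $p\le0.5$), $$\mathbf{Pr}\left(p-\frac1n\sum_{i=1}^nX_i>\delta\right)\le\frac12\exp\left(-\frac{n\delta^2}{2p(1-p)}\right).$$ *)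

(* Defs.v *)
From HB Require Import structures.
From mathcomp Require Import all_boot all_order all_algebra.
From mathcomp Require Import all_classical all_reals all_analysis.

Set Implicit Arguments.
Unset Strict Implicit.
Unset Printing Implicit Defensive.

Import Order.TTheory GRing.Theory Num.Theory.
Import numFieldNormedType.Exports.

Local Open Scope classical_set_scope.
Local Open Scope ring_scope.
Local Open Scope ereal_scope.

(* Mutual (not merely pairwise) independence: the product rule is required for
   every subfamily J, the probabilities being multiplied in \bar R. *)
Definition mutually_independent (d d' : measure_display)
    (T : measurableType d) (T' : measurableType d') (R : realType)
    (P : probability T R) (I : finType) (X : I -> {RV P >-> T'}) : Prop :=
  forall (J : {set I}) (B : I -> set T'),
    (forall i, i \in J -> measurable (B i)) ->
    P (\bigcap_(i in [set` J]) (X i @^-1` B i)) =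
    \prod_(i in J) P (X i @^-1` B i).

(* Main.v *)
Require Import Defs.
From HB Require Import structures.
From mathcomp Require Import all_boot all_order all_algebra.
From mathcomp Require Import all_classical all_reals all_analysis.
From mathcomp Require Import ring lra zify.

Set Implicit Arguments.
Unset Strict Implicit.
Unset Printing Implicit Defensive.

Import Order.TTheory GRing.Theory Num.Theory.
Import numFieldNormedType.Exports.

Local Open Scope classical_set_scope.
Local Open Scope ring_scope.

(** Write m = np and a = n(1 - p), which are integers with m + a = n, let b be
the binomial mass function, and let S be the number of successes. By exchanging
successes and failures, (ii) is (i) for 1 - p, so assume a <= m, i.e. p >= 1/2.
Everything reduces to the tail g(t) = Pr(S > m + t) at integers t >= 0, which is
to be compared with G(t) = exp(- t^2 / (2np(1-p))) / 2; the claim is g <= G, at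
t = k nu.

At t = 0 this says that m is a median. It holds because
b(m + 1 + j) <= b(m - j) for every j < a ([binomial_pmf_reflect_le]): the
successive ratios of these two quantities are rational functions of j, compared
using a <= m.

For t > 0, consider D = G - g. It is nonnegative at 0, and also from t = a on,
where the tail is empty. Its increment D(t+1) - D(t) is
b(m + t + 1) - (G(t) - G(t+1)). When t grows by one, the mass is multiplied by
at most q = exp(- (t + 1) / (np(1-p))) ([binomial_pmf_ratio_le]), and the
decrement of G by at least q ([gaussian_step_ratio_ge]). Hence once D stops
increasing it never increases again, so it is bounded below by its values at the
two ends and is nonnegative ([binomial_tail_le]).

On the probability side, almost surely every X_i is 0 or 1, so an event about
the sum is covered by a null set and by the events {X_i = 1 exactly for i in J},
whose probabilities follow from independence; grouping the sets J by
cardinality gives the binomial masses ([bernoulli_sum_prob_le]). *)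

(** * Two inequalities for the exponential *)

Lemma oneB_mul_expR_antitone (R : realType) (x y : R) :
  0 <= y -> y <= x -> x < 1 -> (1 - x) * expR x <= (1 - y) * expR y.
Proof.
move=> y0 yx x1.
have xyE : expR y = expR x * expR (y - x) by rewrite -expRD addrC subrK.
rewrite xyE mulrCA mulrC ler_pM2l ?expR_gt0//.
apply: (@le_trans _ _ ((1 - y) * (1 + (y - x)))); first by nra.
by rewrite ler_wpM2l ?expR_ge1Dx// subr_ge0; lra.
Qed.

(** This is the inequality tanh x <= x: the difference of the two sides has
derivative x (e^x - e^-x) >= 0 and vanishes at 0. *)
Lemma oneB_mul_expR_le_opp (R : realType) (x : R) :
  0 <= x -> (1 - x) * expR x <= (1 + x) * expR (- x).
Proof.
move=> x0.
pose f (y : R) := (1 + y) * expR (- y) - (1 - y) * expR y.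
have dfE (y : R) : is_derive y 1 f (y * (expR y - expR (- y))).
  by apply: is_derive_eq; rewrite /GRing.scale/=; ring.
suff: f 0 <= f x by rewrite /f oppr0 addr0 subrr subr_ge0.
apply: (@ger0_derive1_ndecry _ f 0) => //.
- move=> y; rewrite in_itv/= andbT => y0.
  rewrite derive1E derive_val mulr_ge0 ?subr_ge0 ?ler_expR; lra.
- apply: derivable_within_continuous => y _; exact: ex_derive.
Qed.

(** * Upper tail of the binomial distribution with integer mean *)

Lemma binomial_pmfE (R : realType) (n j : nat) (p : R) :
  binomial_pmf n p j = p ^+ j * (1 - p) ^+ (n - j) *+ 'C(n, j).
Proof. by []. Qed.

Section binomial_tail.
Variables (R : realType) (m a : nat).
Hypotheses (a_gt0 : (0 < a)%N) (a_le_m : (a <= m)%N).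
Let p : R := m%:R / (m + a)%:R.
Let b := binomial_pmf (m + a) p.

Let m_gt0 : (0 < m)%N. Proof. exact: leq_trans a_gt0 a_le_m. Qed.
Let mR_gt0 : 0 < m%:R :> R. Proof. by rewrite ltr0n. Qed.
Let aR_gt0 : 0 < a%:R :> R. Proof. by rewrite ltr0n. Qed.
Let mR_neq0 : m%:R != 0 :> R. Proof. by rewrite gt_eqF. Qed.
Let aR_neq0 : a%:R != 0 :> R. Proof. by rewrite gt_eqF. Qed.
Let aR_le_mR : a%:R <= m%:R :> R. Proof. by rewrite ler_nat. Qed.

Let p01 : 0 <= p <= 1.
Proof.
rewrite /p divr_ge0 ?ler0n//= ler_pdivrMr ?mul1r ?ler_nat ?leq_addr//.
by rewrite ltr0n addn_gt0 m_gt0.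
Qed.

Let b_ge0 j : 0 <= b j. Proof. exact: binomial_pmf_ge0. Qed.

Lemma onem_pE : 1 - p = a%:R / (m + a)%:R.
Proof. by rewrite /p natrD; field; rewrite -natrD pnatr_eq0; lia. Qed.

(** The division-free form of
b(j+1) / b(j) = (n - j) p / ((j + 1) (1 - p)), valid for all j since both sides
vanish when j >= n. *)
Lemma binomial_pmf_succ j :
  b j.+1 * (j.+1%:R * a%:R) = b j * ((m + a - j)%:R * m%:R).
Proof.
have [jn|nj] := ltnP j (m + a); last first.
  by rewrite /b !binomial_pmfE bin_small ?ltnS// (eqP nj) mulr0n !mul0r mulr0.
have binE := congr1 (fun x => x%:R : R) (mul_bin_left (m + a) j).
rewrite !natrM in binE.
have paE : p * a%:R = a%:R / (m + a)%:R * m%:R by rewrite /p; ring.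
rewrite /b !binomial_pmfE -[_ *+ _]mulr_natr -[X in _ = X * _]mulr_natr.
rewrite -{1}(@subnSK j (m + a))// !exprS onem_pE.
rewrite [LHS](_ : _ = p ^+ j * (a%:R / (m + a)%:R) ^+ (m + a - j.+1)
  * (p * a%:R) * (j.+1%:R * 'C(m + a, j.+1)%:R)); last by ring.
rewrite binE paE; ring.
Qed.

Lemma binomial_pmf_sum1 : \sum_(0 <= j < (m + a).+1) b j = 1.
Proof.
have := exprDn (1 - p) p (m + a); rewrite subrK expr1n big_mkord => ->.
by apply: eq_bigr => j _; rewrite /b !binomial_pmfE mulrC.
Qed.

(** Passing from j to j + 1 multiplies the quotient b(m+j+1) / b(m-j) by
(a^2 - i^2) m^2 / (a^2 ((m+1)^2 - i^2)), where i = j + 1, and this factor is at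
most 1 because a <= m. *)
Lemma binomial_pmf_reflect_le j : (j < a)%N -> b (m + j.+1) <= b (m - j).
Proof.
elim: j => [|j IH] ja.
  rewrite addn1 subn0.
  have := binomial_pmf_succ m; rewrite addKn => bE.
  have : b m.+1 * (m.+1%:R * a%:R) <= b m * (m.+1%:R * a%:R).
    rewrite bE ler_wpM2l// mulrC ler_pM2r// ler_nat; lia.
  by rewrite ler_pM2r// mulr_gt0.
have {}IH := IH (ltnW ja).
have := binomial_pmf_succ (m + j.+1).
have := binomial_pmf_succ (m - j.+1).
rewrite (_ : (m - j.+1).+1 = m - j)%N; last by lia.
rewrite (_ : m + a - (m - j.+1) = a + j.+1)%N; last by lia.
rewrite (_ : m + a - (m + j.+1) = a - j.+1)%N; last by lia.
rewrite -addnS.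
set b1 := b (m - j); set b2 := b (m - j.+1).
set b3 := b (m + j.+2); set b4 := b (m + j.+1) => E1 E2.
have sub1 : (a - j.+1)%:R = a%:R - j.+1%:R :> R by rewrite natrB// ltnW.
have sub2 : (m - j)%:R = m%:R - j%:R :> R by rewrite natrB//; lia.
have j0 : 0 <= j%:R :> R by rewrite ler0n.
have K_gt0 : 0 < (m + j.+2)%:R * a%:R * ((m - j)%:R * a%:R) :> R.
  by rewrite !mulr_gt0// ltr0n; lia.
rewrite -(ler_pM2r K_gt0).
apply: (@le_trans _ _ (b1 * ((a - j.+1)%:R * m%:R * ((m - j)%:R * a%:R)))).
  by rewrite (mulrA b3) E2 -(mulrA b4) ler_wpM2r.
rewrite (_ : b1 * _ = b1 * ((m - j)%:R * a%:R) * ((a - j.+1)%:R * m%:R));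
  last by ring.
rewrite E1 -mulrA ler_wpM2l ?b_ge0//.
rewrite sub1 sub2 -addn2 -addn1 !natrD.
have am2 : 0 <= m%:R ^+ 2 - a%:R ^+ 2 :> R.
  by rewrite subr_ge0 lerXn2r// nnegrE ler0n.
(* This is a^2 ((m+1)^2 - i^2) - (a^2 - i^2) m^2 with i = j + 1. *)
have gap_ge0 : 0 <= a%:R ^+ 2 * (2 * m%:R + 1)
    + (j%:R + 1) ^+ 2 * (m%:R ^+ 2 - a%:R ^+ 2) :> R.
  apply: addr_ge0; apply: mulr_ge0 => //; rewrite ?exprn_ge0 ?addr_ge0// mulr_ge0.
by move: gap_ge0; rewrite -subr_ge0; lra.
Qed.

Let g t := \sum_((m + t).+1 <= j < (m + a).+1) b j.

(** An integer mean is a median: the masses above m are dominated one by one by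
the masses at m and below, and the total mass is 1. *)
Lemma binomial_tail_le_half : g 0 <= 2^-1.
Proof.
have g0E : g 0 = \sum_(0 <= j < a) b (m + j.+1).
  rewrite /g addn0 -{1}(add0n m.+1) big_addn.
  rewrite (_ : (m + a).+1 - m.+1 = a)%N; last by lia.
  by apply: eq_bigr => j _; rewrite addnC addSnnS.
have headE : \sum_(0 <= j < m.+1) b j = 1 - g 0.
  rewrite -binomial_pmf_sum1 [X in _ = X - _](big_cat_nat (n := m.+1))//=.
    by rewrite /g addn0 addrK.
  by rewrite ltnS leq_addr.
have : g 0 <= 1 - g 0.
  rewrite -headE g0E [leRHS]big_nat_rev/= add0n.
  rewrite [leRHS](big_cat_nat (n := a))//=; last by rewrite ltnW.
  rewrite -[leLHS]addr0 lerD ?sumr_ge0//.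
  rewrite big_nat_cond [leRHS]big_nat_cond; apply: ler_sum => j.
  by rewrite andbT subSS => /andP[_ /binomial_pmf_reflect_le].
by lra.
Qed.

(** Since 1/(np) + 1/(n(1-p)) = 1/(np(1-p)), [A] is one over twice the variance
and [G] is the bound to be proved. *)
Let A : R := (m%:R^-1 + a%:R^-1) / 2.
Let G (t : nat) : R := 2^-1 * expR (- (A * t%:R ^+ 2)).

(** With x = t/a and y = t/m, the ratio of the masses is
(1 - x) / (1 + (t + 1)/m) <= (1 - x) / (1 + y), and 1 / (np(1-p)) = 1/a + 1/m, so
it suffices that (1 - x) e^x <= (1 + y) e^-y. As y <= x, the intermediate
quantity (1 - y) e^y separates the two sides. *)
Lemma binomial_pmf_ratio_le t :
  b (m + t).+1 <= expR (- (2 * A * t%:R)) * b (m + t).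
Proof.
have [ta|at_] := ltnP t a; last first.
  rewrite [b _.+1](_ : _ = 0); first by rewrite mulr_ge0 ?expR_ge0.
  by rewrite /b binomial_pmfE bin_small ?mulr0n//; lia.
have t0 : 0 <= t%:R :> R by rewrite ler0n.
have taR : t%:R < a%:R :> R by rewrite ltr_nat.
pose x : R := t%:R / a%:R; pose y : R := t%:R / m%:R.
have y0 : 0 <= y by rewrite divr_ge0.
have yx : y <= x by rewrite ler_wpM2l// lef_pV2.
have x1 : x < 1 by rewrite ltr_pdivrMr// mul1r.
have xy_le : 1 - x <= (1 + y) * expR (- (2 * A * t%:R)).
  rewrite (_ : 2 * A * t%:R = x + y); last first.
    by rewrite /A /x /y; field; rewrite mR_neq0 aR_neq0.
  rewrite opprD (addrC (- x)) expRD mulrA.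
  rewrite [expR (- x)]expRN ler_pdivlMr ?expR_gt0//.
  exact: le_trans (oneB_mul_expR_antitone y0 yx x1) (oneB_mul_expR_le_opp y0).
have := binomial_pmf_succ (m + t).
rewrite subnDl natrB; last exact: ltnW.
have st_gt0 : 0 < (m + t).+1%:R * a%:R :> R by rewrite mulr_gt0// ltr0n.
move=> bE; rewrite -(ler_pM2r st_gt0) bE mulrC [leRHS]mulrC mulrA.
rewrite ler_wpM2r//.
have -> : (a%:R - t%:R) * m%:R = (1 - x) * (m%:R * a%:R) by rewrite /x; field.
apply: (le_trans (ler_wpM2r _ xy_le)); first by rewrite mulr_ge0.
have -> : (1 + y) * expR (- (2 * A * t%:R)) * (m%:R * a%:R) =
    (m + t)%:R * a%:R * expR (- (2 * A * t%:R)) by rewrite /y natrD; field.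
by rewrite ler_wpM2r ?expR_ge0// ler_wpM2r// ler_nat.
Qed.

(** With e = exp(-A) and r the factor on the left, G(t) and G(t+2) are multiples
of G(t+1), and the inequality becomes e - r <= 1 - e r, that is
(1 - e) (1 + r) >= 0. *)
Lemma gaussian_step_ratio_ge t :
  expR (- (2 * A * t.+1%:R)) * (G t - G t.+1) <= G t.+1 - G t.+2.
Proof.
set r := expR _; set e := expR (- A).
have e1 : e <= 1.
  by rewrite -expR0 ler_expR oppr_le0 divr_ge0 ?addr_ge0 ?invr_ge0.
have rG : r * G t = e * G t.+1.
  rewrite /G !(mulrCA _ 2^-1) -!expRD; congr (_ * expR _).
  by rewrite -natr1; ring.
have G2 : G t.+2 = e * r * G t.+1.
  rewrite /G !(mulrCA _ 2^-1) -!expRD; congr (_ * expR _).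
  by rewrite -!natr1; ring.
have r0 : 0 < r by exact: expR_gt0.
have G0 : 0 < G t.+1 by rewrite mulr_gt0 ?expR_gt0.
rewrite mulrBr rG G2.
have : 0 <= (1 - e) * (1 + r) * G t.+1.
  by apply: mulr_ge0; [apply: mulr_ge0; lra | exact: ltW].
lra.
Qed.

(** The predicate [falls i] says that G - g does not increase from i to i + 1. It
propagates upwards. If it holds at t, then G - g is nonincreasing from t on and
is nonnegative at t + a; otherwise G - g increases all the way from 0 to t, and
it is nonnegative at 0. *)
Lemma binomial_tail_le t : g t <= G t.
Proof.
have b_eq0 j : (m + a < j)%N -> b j = 0.
  by move=> aj; rewrite /b binomial_pmfE bin_small.
have gS i : g i = b (m + i).+1 + g i.+1.
  rewrite /g addnS; have [ia|ai] := ltnP i a; first by rewrite big_ltn//; lia.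
  by rewrite !big_geq ?b_eq0 ?addr0//; lia.
have G_ge0 i : 0 <= G i by rewrite mulr_ge0 ?expR_ge0.
have g_big i : (a <= i)%N -> g i <= G i.
  by move=> ai; rewrite /g big_geq//; lia.
pose falls i := b (m + i).+1 <= G i - G i.+1.
have falls_succ i : falls i -> falls i.+1.
  rewrite /falls => falls_i; apply: le_trans (gaussian_step_ratio_ge i).
  rewrite addnS; apply: le_trans (_ : _ <= _) _.
    by rewrite -addnS; exact: binomial_pmf_ratio_le.
  by rewrite ler_wpM2l ?expR_ge0// addnS.
have falls_add i j : falls i -> falls (i + j)%N.
  by move=> falls_i; elim: j => [|j IH]; rewrite ?addn0// addnS falls_succ.
have [falls_t|rises_t] := boolP (falls t).
  suff desc i : g (t + i)%N <= G (t + i)%N -> g t <= G t.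
    by apply: (desc a); apply: g_big; rewrite leq_addl.
  elim: i => [|i IH]; first by rewrite addn0.
  rewrite addnS => gG; apply: IH.
  have := falls_add _ i falls_t; rewrite /falls gS; lra.
have rises_below i : (i <= t)%N -> ~~ falls i.
  by move=> it; apply: contra rises_t => falls_i; rewrite -(subnKC it) falls_add.
elim: (t) rises_below => [|i IH] rises.
  by rewrite (le_trans binomial_tail_le_half)// /G expr0n mulr0 oppr0 expR0 mulr1.
have := rises _ (leqnSn i); rewrite /falls -ltNge.
have := IH (fun j ji => rises j (leqW ji)); rewrite gS; lra.
Qed.

End binomial_tail.

(** * Sums of independent Bernoulli variables *)

Section bernoulli_sum.
Context (R : realType) (n : nat) (p : R) (d : measure_display).
Context (T : measurableType d) (P : probability T R) (X : 'I_n -> {RV P >-> R}).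
Hypotheses (X_indep : mutually_independent X)
  (X_1 : forall i, P [set w | X i w = 1] = p%:E)
  (X_0 : forall i, P [set w | X i w = 0] = (1 - p)%:E).

Let pattern (J : {set 'I_n}) : set T :=
  \bigcap_(i in [set` finset.setTfor 'I_n]) (X i @^-1` [set (i \in J)%:R]).

Lemma measurable_RV_eq i (x : R) : measurable [set w | X i w = x].
Proof.
rewrite -[X in measurable X]setTI.
exact: (measurable_funP (X i) measurableT _ (measurable_set1 x)).
Qed.

Lemma measurable_pattern J : measurable (pattern J).
Proof. by apply: fin_bigcap_measurable => // i _; exact: measurable_RV_eq. Qed.

Lemma pattern_probE J :
  P (pattern J) = (p ^+ #|J| * (1 - p) ^+ (n - #|J|))%:E.
Proof.
rewrite /pattern X_indep => [|i _]; last exact: measurable_set1.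
rewrite (eq_bigr (fun i => (if i \in J then p else 1 - p)%:E)) => [|i _].
  rewrite prodEFin (eq_bigl xpredT) => [|i]; last by rewrite finset.in_setT.
  rewrite (bigID (mem J))/= (eq_bigr (fun=> p)) => [|i ->//].
  rewrite [X in _ * X](eq_bigr (fun=> 1 - p)) => [|i /negbTE ->//].
  rewrite !prodr_const; congr (_ * _ ^+ _)%:E.
  by have := cardC (mem J); rewrite card_ord => cJ; rewrite -[LHS](addKn #|J|) cJ.
by case: ifP => _; [exact: X_1|exact: X_0].
Qed.

Lemma measure_big_setU_le (I : Type) (s : seq I) (Q : pred I) (F : I -> set T) :
  (forall i, measurable (F i)) ->
  (P (\big[setU/set0]_(i <- s | Q i) F i) <= \sum_(i <- s | Q i) P (F i))%E.
Proof.
move=> mF; elim: s => [|i s IH]; first by rewrite !big_nil measure0.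
rewrite !big_cons; case: ifP => // _.
apply: (le_trans (measureU2 _ _ _)) => //; last exact: leeD.
exact: bigsetU_measurable.
Qed.

(** The variables are only known to be 0 or 1 almost surely; [bad] collects the
exceptional points. *)
Let bad : set T :=
  \big[setU/set0]_(i < n) ~` ([set w | X i w = 1] `|` [set w | X i w = 0]).

Let measurable_bad_i i :
  measurable (~` ([set w | X i w = 1] `|` [set w | X i w = 0])).
Proof. by apply/measurableC/measurableU; exact: measurable_RV_eq. Qed.

Lemma bad_prob0 : P bad = 0%E.
Proof.
apply/eqP; rewrite -measure_le0 (le_trans (measure_big_setU_le _ _ _))//.
rewrite big1// => i _; rewrite probability_setC; last first.
  by apply: measurableU; exact: measurable_RV_eq.
have PU : P ([set w | X i w = 1] `|` [set w | X i w = 0]) =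
    (p%:E + (1 - p)%:E)%E.
  rewrite -(X_1 i) -(X_0 i); apply: measureU.
  - exact: measurable_RV_eq.
  - exact: measurable_RV_eq.
  - by apply/seteqP; split => // w [/= -> /eqP]; rewrite oner_eq0.
rewrite PU -EFinD addrC subrK; exact: (@subee _ 1%:E).
Qed.

Lemma bernoulli_sum_cover (Q : set R) :
  [set w | Q (\sum_(i < n) X i w)] `<=`
  bad `|` \big[setU/set0]_(J : {set 'I_n} | `[< Q #|J|%:R >]) pattern J.
Proof.
move=> w /= Qw; have [goodw|] := pselect (forall i, X i w = 1 \/ X i w = 0).
  right; rewrite -bigcup_seq_cond.
  have XE i : X i w = (i \in [set i | X i w == 1]%SET)%:R.
    by rewrite finset.inE; case: (goodw i) => ->; rewrite ?eqxx// eq_sym oner_eq0.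
  exists [set i | X i w == 1]%SET => /=; last by move=> i _; exact: XE.
  rewrite mem_index_enum/=; apply/asboolP.
  move: Qw; rewrite (eq_bigr _ (fun i _ => XE i)) -natr_sum.
  by rewrite -sum1_card -big_mkcond.
move=> /existsNP[i iw]; left.
by rewrite /bad -bigcup_seq; exists i => //=; rewrite mem_index_enum.
Qed.

Lemma sum_pattern_prob (Q : pred nat) :
  \sum_(J : {set 'I_n} | Q #|J|) p ^+ #|J| * (1 - p) ^+ (n - #|J|) =
  \sum_(j < n.+1 | Q j) binomial_pmf n p j.
Proof.
have J_lt (J : {set 'I_n}) : (#|J| < n.+1)%N.
  by rewrite ltnS -[leqRHS]card_ord max_card.
rewrite (partition_big (fun J : {set 'I_n} => Ordinal (J_lt J)) (fun j => Q j))//=.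
apply: eq_bigr => j Qj.
rewrite (eq_big (fun J : {set 'I_n} => #|J| == j)
  (fun=> p ^+ j * (1 - p) ^+ (n - j))) => [|J|J].
- rewrite sumr_const binomial_pmfE; congr (_ *+ _).
  by have := card_draws 'I_n j; rewrite card_ord cardsE.
- by rewrite -val_eqE/=; case: eqP => [->|]; rewrite ?Qj ?andbF.
- by rewrite -val_eqE/= => /andP[_ /eqP ->].
Qed.

(** Union bound over the cover of the event by the null set and the patterns. *)
Lemma bernoulli_sum_prob_le (Q : set R) : measurable Q ->
  (P [set w | Q (\sum_(i < n) X i w)%R] <=
   (\sum_(j < n.+1 | `[< Q j%:R >]) binomial_pmf n p j)%R%:E)%E.
Proof.
move=> mQ.
have mE : measurable [set w | Q (\sum_(i < n) X i w)].
  have mS : measurable_fun setT (fun w => \sum_(i < n) X i w).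
    exact: measurable_sum.
  by rewrite -[X in measurable X]setTI; exact: mS.
have mbad : measurable bad by exact: bigsetU_measurable.
pose U := \big[setU/set0]_(J : {set 'I_n} | `[< Q #|J|%:R >]) pattern J.
have mU : measurable U.
  by apply: bigsetU_measurable => J _; exact: measurable_pattern.
apply: (@le_trans _ _ (P (bad `|` U))).
  by apply: le_measure; rewrite ?inE; [|exact: measurableU|exact: bernoulli_sum_cover].
apply: (@le_trans _ _ (P bad + P U)%E); first exact: measureU2.
rewrite bad_prob0 add0e (le_trans (measure_big_setU_le _ _ measurable_pattern))//.
rewrite (eq_bigr _ (fun J _ => pattern_probE J)) sumEFin.
by rewrite (sum_pattern_prob (fun j => `[< Q j%:R >])).
Qed.

Lemma bernoulli_sum_upper_tail (m a t : nat) : n = (m + a)%N ->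
  p = m%:R / (m + a)%:R -> (0 < a <= m)%N ->
  (P [set w | ((m + t)%:R < \sum_(i < n) X i w)%R] <=
   (2^-1 * expR (- ((m%:R^-1 + a%:R^-1) / 2 * t%:R ^+ 2)))%:E)%E.
Proof.
move=> nE pE /andP[a_gt0 am].
pose Q : set R := [set x | (m + t)%:R < x].
have mQ : measurable Q by rewrite /Q -set_itvoy.
apply: (le_trans (bernoulli_sum_prob_le mQ)); rewrite lee_fin.
apply: le_trans (binomial_tail_le R a_gt0 am t).
rewrite -pE -nE (big_nat_widenl _ 0)// big_mkord.
by under eq_bigl do rewrite asboolb ltr_nat.
Qed.

(** The reversal j -> n - j counts failures instead of successes: the lower tail
for p is the upper tail for 1 - p, whose mean a is at least m. *)
Lemma bernoulli_sum_lower_tail (m a t : nat) : n = (m + a)%N ->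
  p = m%:R / (m + a)%:R -> (0 < m <= a)%N ->
  (P [set w | (\sum_(i < n) X i w + t%:R < m%:R)%R] <=
   (2^-1 * expR (- ((a%:R^-1 + m%:R^-1) / 2 * t%:R ^+ 2)))%:E)%E.
Proof.
move=> nE pE /andP[m_gt0 ma].
pose Q : set R := [set x | x + t%:R < m%:R].
have mQ : measurable Q.
  rewrite /Q; under eq_set do rewrite -ltrBrDr.
  by rewrite -set_itvNyo.
apply: (le_trans (bernoulli_sum_prob_le mQ)); rewrite lee_fin.
apply: le_trans (binomial_tail_le R m_gt0 ma t).
have qE : a%:R / (a + m)%:R = 1 - p.
  by rewrite pE natrD [in RHS]natrD; field; rewrite -natrD pnatr_eq0; lia.
rewrite qE [(a + m)%N]addnC -nE (big_nat_widenl _ 0)// big_mkord.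
rewrite (reindex_inj rev_ord_inj)/=.
rewrite le_eqVlt; apply/orP; left; apply/eqP; apply: eq_big => j;
  have jn : (j <= n)%N by rewrite -ltnS.
  by rewrite asboolb subSS -natrD ltr_nat; lia.
move=> _; rewrite subSS !binomial_pmfE subKn// bin_sub//.
by rewrite subKr mulrC.
Qed.

End bernoulli_sum.

Theorem proposition2 (R : realType) (k r s nu n : nat) (p eps delta : R)
    (d : measure_display) (T : measurableType d) (P : probability T R)
    (X : 'I_n -> {RV P >-> R})
    (k_gt0 : (0 < k)%N) (r_gt0 : (0 < r)%N)
    (s_gt0 : (0 < s)%N) (nu_gt0 : (0 < nu)%N)
    (pE : p = r%:R / (r + s)%:R)
    (nE : n = (k * (r + s))%N)
    (epsE : eps = 1 / (r + s)%:R)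
    (deltaE : delta = nu%:R * eps)
    (X_indep : mutually_independent X)
    (X_1 : forall i, P [set w | X i w = 1] = p%:E)
    (X_0 : forall i, P [set w | X i w = 0] = (1 - p)%:E) :
  ((s <= r)%N ->
    (P [set w | (delta < n%:R^-1 * (\sum_(i < n) X i w) - p)%R]
     <= (2^-1 * expR (- (n%:R * delta ^+ 2 / (2 * p * (1 - p)))))%:E)%E) /\
  ((r <= s)%N ->
    (P [set w | (delta < p - n%:R^-1 * (\sum_(i < n) X i w))%R]
     <= (2^-1 * expR (- (n%:R * delta ^+ 2 / (2 * p * (1 - p)))))%:E)%E).
Proof.
have n_gt0 : 0 < n%:R :> R by rewrite ltr0n nE muln_gt0 k_gt0 addn_gt0 r_gt0.
have rsE : n = (k * r + k * s)%N by rewrite nE mulnDr.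
have kR : k%:R != 0 :> R by rewrite pnatr_eq0 -lt0n.
have rR : r%:R != 0 :> R by rewrite pnatr_eq0 -lt0n.
have sR : s%:R != 0 :> R by rewrite pnatr_eq0 -lt0n.
have rsR : r%:R + s%:R != 0 :> R.
  by rewrite -natrD pnatr_eq0 -lt0n addn_gt0 r_gt0.
have npE : n%:R * p = (k * r)%:R.
  by rewrite pE nE !natrM !natrD; field.
have ndE : n%:R * delta = (k * nu)%:R.
  by rewrite deltaE epsE nE !natrM !natrD; field.
have pE' : p = (k * r)%:R / (k * r + k * s)%:R.
  by rewrite -rsE -npE mulrAC divff ?mul1r// gt_eqF.
have expE : n%:R * delta ^+ 2 / (2 * p * (1 - p)) =
    ((k * r)%:R^-1 + (k * s)%:R^-1) / 2 * (k * nu)%:R ^+ 2.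
  rewrite deltaE epsE pE nE !natrM !natrD; field.
  by rewrite sR kR rR.
split=> rs; rewrite expE.
- have -> : [set w | (delta < n%:R^-1 * (\sum_(i < n) X i w) - p)%R] =
      [set w | ((k * r + k * nu)%:R < \sum_(i < n) X i w)%R].
    apply: eq_set => w; congr is_true.
    by rewrite ltrBrDl ltr_pdivlMl// natrD -npE -ndE mulrDr.
  apply: bernoulli_sum_upper_tail => //.
  by rewrite muln_gt0 k_gt0 s_gt0 leq_mul2l rs orbT.
- have -> : [set w | (delta < p - n%:R^-1 * (\sum_(i < n) X i w))%R] =
      [set w | (\sum_(i < n) X i w + (k * nu)%:R < (k * r)%:R)%R].
    apply: eq_set => w; congr is_true.
    by rewrite ltrBrDl -ltrBrDr ltr_pdivrMl// mulrBr npE ndE ltrBrDr.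
  rewrite (addrC (k * r)%:R^-1).
  apply: bernoulli_sum_lower_tail => //.
  by rewrite muln_gt0 k_gt0 r_gt0 leq_mul2l rs orbT.
Qed.
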